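(* Let $\alpha_c(2)$ be the critical value for Bernoulli parking on the infinite binary tree $\mathbb T_2$. Then $$0.03175<\alpha_c(2)<0.08698.$$
   Context: Parking process: on a tree with root $\rho$, each vertex has one parking spot. Initially (time $0$) $\eta_v$ cars arrive to each vertex $v$. Cars move towards the root in discrete time, one edge per time step. When a car arrives at an available spot it parks there and the spot becomes unavailable; if several cars arrive at the same available spot simultaneously, one chosen uniformly at random parks there and the others continue towards the root. (This applies also to the cars arriving initially at a vertex.) $X\in\{0,1,\dots\}\cup\{\infty\}$ is the total number of cars that ever arrive to $\rho$, including the $\eta_\rho$ cars initially there. $\mathbb T_2$ is the infinite rooted tree in which each vertex has $2$ children. Bernoulli parking with parameter $\alpha\in[0,2]$: the $\eta_v$ are i.i.d., equal to $2$ with probability $\alpha/2$ and $0$ otherwise (so $E\eta_v=\alpha$). $\alpha_c(2)\in(0,1)$ is the number such that, for Bernoulli parking on $\mathbb T_2$, $EX<\infty$ for $\alpha<\alpha_c(2)$ and $X=\infty$ almost surely for $\alpha>\alpha_c(2)$ (its existence is a theorem of Goldschmidt and Przykucki). *)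

(* Defs.v *)
From mathcomp Require Import all_boot all_order all_algebra.
From mathcomp Require Import all_classical all_reals all_analysis.

Set Implicit Arguments.
Unset Strict Implicit.
Unset Printing Implicit Defensive.

Import Order.TTheory GRing.Theory Num.Theory.
Import numFieldNormedType.Exports.

Local Open Scope classical_set_scope.
Local Open Scope ring_scope.

(* The infinite binary tree: [::] is the root, and the children of v are
   false :: v and true :: v, so that the parent of b :: v is v. *)
Notation vertex := (seq bool).

(* (v, i) is the i-th of the cars initially at v. *)
Notation car := (vertex * nat)%type.

Section Dynamics.
(* When n.+1 cars arrive simultaneously at v while its spot is available, the
   car of rank tie v n among them (in the deterministic order in which the
   process lists them) parks. Since the spot is then no longer available, for
   each v at most one of the choices tie v n is ever used. *)
Variables (eta : vertex -> nat) (tie : vertex -> forall n : nat, 'I_n.+1).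

Definition leaving (v : vertex) (available : bool) (s : seq car) : seq car :=
  match s with
  | [::] => [::]
  | _ :: s' =>
      if available then take (tie v (size s')) s ++ drop (tie v (size s')).+1 s
      else s
  end.

(* (process t v).1 lists the cars arriving at v at time t, and (process t v).2
   tells whether the spot at v is available just before their arrival. *)
Fixpoint process (t : nat) (v : vertex) : seq car * bool :=
  match t with
  | 0%N => ([seq (v, i) | i <- iota 0 (eta v)], true)
  | t'.+1 =>
      (leaving (false :: v) (process t' (false :: v)).2
               (process t' (false :: v)).1
         ++ leaving (true :: v) (process t' (true :: v)).2
               (process t' (true :: v)).1,
       (process t' v).2 && nilp (process t' v).1)
  end.

Definition visits (R : realType) : \bar R :=
  (\sum_(0 <= t <oo) (size (process t [::]).1)%:R%:E)%E.

End Dynamics.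

(* Mutual independence of random variables with values in countable sets, all
   of whose subsets are measurable. *)
Definition mutually_independent d (T : measurableType d) (R : realType)
    (P : probability T R) (I : eqType) (S : I -> Type)
    (X : forall i, T -> S i) : Prop :=
  forall (J : seq I) (B : forall i, set (S i)), uniq J ->
    P (\bigcap_(i in [set` J]) (X i @^-1` B i))
      = (\prod_(i <- J) P (X i @^-1` B i))%E.

Record parking_model (R : realType) := ParkingModel {
  pm_display : measure_display;
  pm_space : measurableType pm_display;
  pm_prob : probability pm_space R;
  pm_eta : vertex -> pm_space -> nat;
  pm_tie : vertex -> forall n : nat, pm_space -> 'I_n.+1
}.

(* inl v indexes the number of cars at v, and inr (v, n) the choice made at v
   among n.+1 cars. *)
Notation source := (vertex + vertex * nat)%type.

Definition source_value (i : source) : Type :=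
  match i with
  | inl _ => nat
  | inr vn => 'I_(vn.2).+1
  end.

Definition pm_source (R : realType) (M : parking_model R) (i : source) :
    pm_space M -> source_value i :=
  match i return pm_space M -> source_value i with
  | inl v => pm_eta v
  | inr vn => @pm_tie R M vn.1 vn.2
  end.

Definition bernoulli_parking (R : realType) (alpha : R) (M : parking_model R) :
    Prop :=
  [/\ forall i (B : set (source_value i)), measurable (@pm_source R M i @^-1` B),
      mutually_independent (pm_prob M) (@pm_source R M),
      forall v, pm_prob M (@pm_eta R M v @^-1` [set 2%N]) = (alpha / 2)%:E /\
                pm_prob M (@pm_eta R M v @^-1` [set 0%N]) = (1 - alpha / 2)%:E
    & forall v n (k : 'I_n.+1),
        pm_prob M (@pm_tie R M v n @^-1` [set k]) = (n.+1%:R^-1)%:E].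

Definition pm_X (R : realType) (M : parking_model R) (w : pm_space M) : \bar R :=
  visits (fun v => pm_eta v w) (fun v n => pm_tie v n w) R.

(* M gives, for each parameter, a probability space carrying the Bernoulli
   parking process with that parameter; no coupling between them is assumed. *)
Definition is_critical_value (R : realType) (M : R -> parking_model R)
    (alpha_c : R) : Prop :=
  [/\ 0 < alpha_c < 1,
      forall alpha, 0 <= alpha < alpha_c ->
        (\int[pm_prob (M alpha)]_w pm_X w < +oo)%E
    & forall alpha, alpha_c < alpha <= 2 ->
        {ae pm_prob (M alpha), forall w, pm_X w = +oo%E}].

(* Main.v *)
(** The total number of cars visiting a vertex up to time n does not depend on
the tie-breaking: N_{n+1}(v) = eta v + (N_n(v0) - 1)^+ + (N_n(v1) - 1)^+, with
independent terms, so the generating polynomials satisfy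
G_{n+1}(z) = phi(z) ((G_n(z) - G_n(0)) / z + G_n(0))^2 with
phi(z) = 1 - alpha/2 + (alpha/2) z^2, and E X = lim G_n'(1).

Lower bound: at alpha = 32/1000 the recursion at z = 4 preserves G_n(4) <= 3, so
E X <= 3.

Upper bound: if E X were finite at alpha = 2/23, the coefficients of G_n would
converge to a law g with mean 2 (1 - g_0) - alpha. With s = g_0 + g_1 the
recursion determines g_0, ..., g_5 as functions of s, and the mean is then less
than E min(N, 3) when s < 62/100 and less than E min(N, 6) when s >= 62/100. *)
Require Import Defs.
From mathcomp Require Import all_boot all_order all_algebra.
From mathcomp Require Import all_classical all_reals all_analysis.
From mathcomp Require Import measurable_realfun ring lra zify.

Set Implicit Arguments.
Unset Strict Implicit.
Unset Printing Implicit Defensive.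

Import Order.TTheory GRing.Theory Num.Theory.
Import numFieldNormedType.Exports.

Local Open Scope classical_set_scope.
Local Open Scope ring_scope.

(** * Total arrivals up to time n and their recursion over the tree *)

Section Counts.
Variables (eta : vertex -> nat) (tie : vertex -> forall n : nat, 'I_n.+1).

Definition arrivals (n : nat) (v : vertex) : nat :=
  (\sum_(t < n.+1) size (process eta tie t v).1)%N.

Lemma size_leaving v b (s : seq car) :
  size (leaving tie v b s) = if b then (size s).-1 else size s.
Proof.
case: s => [|x s]; first by case: b.
rewrite /leaving; case: b => //.
rewrite size_cat size_take size_drop /=.
by rewrite ltn_ord subSS subnKC // -ltnS ltn_ord.
Qed.

Lemma process_available t v :
  (process eta tie t v).2 =
  (\sum_(i < t) size (process eta tie i v).1 == 0)%N.
Proof.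
elim: t => [|t IHt] /=; first by rewrite big_ord0.
by rewrite big_ord_recr /= addn_eq0 -IHt /nilp.
Qed.

(** The spot takes exactly one car from the first nonempty group to arrive and none afterwards,
    whichever car [tie] selects. *)
Lemma sum_leaving n v :
  (\sum_(t < n.+1) size (leaving tie v (process eta tie t v).2
                           (process eta tie t v).1))%N = (arrivals n v).-1.
Proof.
rewrite /arrivals; elim: n => [|n IHn].
  by rewrite !big_ord_recr !big_ord0 size_leaving.
rewrite big_ord_recr IHn [in RHS]big_ord_recr /= size_leaving.
rewrite [_ && _](process_available n.+1 v).
set S := (\sum_(i < n.+1) _)%N; case: eqP; lia.
Qed.

Lemma arrivalsS n v :
  arrivals n.+1 v =
  (eta v + ((arrivals n (false :: v)).-1 + (arrivals n (true :: v)).-1))%N.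
Proof.
rewrite {1}/arrivals big_ord_recl /= size_map size_iota -!sum_leaving.
by rewrite -big_split /=; congr addn; apply: eq_bigr => i _; rewrite size_cat.
Qed.

Lemma arrivals0 v : arrivals 0 v = eta v.
Proof. by rewrite /arrivals big_ord_recr big_ord0 /= size_map size_iota. Qed.

Lemma arrivals_homo n v : (arrivals n v <= arrivals n.+1 v)%N.
Proof. by rewrite /arrivals [leqRHS]big_ord_recr leq_addr. Qed.

End Counts.

(** * The recursion for generating polynomials, their values and derivatives at 1 *)

Section GeneratingPolynomials.
Variables (R : realType) (alpha : R).

Definition eta_poly : {poly R} := (1 - alpha / 2)%:P + (alpha / 2)%:P * 'X^2.

(* If p generates the law of N, then [shiftp p] generates that of (N - 1)^+. *)
Definition shiftp (p : {poly R}) : {poly R} := drop_poly 1 p + (p`_0)%:P.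

Fixpoint genp (n : nat) : {poly R} :=
  if n is n'.+1 then eta_poly * (shiftp (genp n') * shiftp (genp n'))
  else eta_poly.

Lemma coef_eta_poly k :
  eta_poly`_k = if k == 0%N then 1 - alpha / 2
                else if k == 2%N then alpha / 2 else 0.
Proof.
rewrite /eta_poly coefD coefC coefCM coefXn.
by case: k => [|[|[|k]]] /=; rewrite ?mulr0 ?mulr1 ?addr0 ?add0r.
Qed.

Lemma coef_shiftp p k :
  (shiftp p)`_k = p`_k.+1 + (if k == 0%N then p`_0 else 0).
Proof. by rewrite coefD coefC coef_drop_poly addn1. Qed.

(** The formula (p - p_0) / X + p_0 cleared of its denominator; evaluation and differentiation at 1
    are both read off from it. *)
Lemma mul_shiftpX p : shiftp p * 'X = p + (p`_0)%:P * ('X - 1).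
Proof.
have dropE : drop_poly 1 p * 'X = p - take_poly 1 p.
  by apply/eqP; rewrite eq_sym subr_eq addrC -['X]expr1 poly_take_drop.
have c0E : (p`_0)%:P = take_poly 1 p.
  by apply/polyP=> -[|i]; rewrite coef_take_poly coefC.
by rewrite /shiftp mulrDl dropE c0E mulrBr mulr1 -addrA (addrC _ (_ * 'X)).
Qed.

Lemma horner_shiftp p x : (shiftp p).[x] * x = p.[x] + p`_0 * (x - 1).
Proof.
by rewrite -hornerMX mul_shiftpX hornerD hornerCM hornerD hornerX hornerN
           hornerC.
Qed.

Lemma horner1_shiftp p : (shiftp p).[1] = p.[1].
Proof. by rewrite -[LHS]mulr1 horner_shiftp subrr mulr0 addr0. Qed.

Lemma horner1_eta_poly : eta_poly.[1] = 1.
Proof. by rewrite /eta_poly !hornerE /=; ring. Qed.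

Lemma horner1_genp n : (genp n).[1] = 1.
Proof.
elim: n => [|n IHn] /=; first exact: horner1_eta_poly.
by rewrite !hornerM horner1_shiftp horner1_eta_poly IHn !mulr1.
Qed.

Lemma deriv1_shiftp p : (shiftp p)^`().[1] = p^`().[1] - p.[1] + p`_0.
Proof.
have := congr1 (fun q => q^`().[1]) (mul_shiftpX p) => /=.
rewrite derivM derivX mulr1 derivD derivM derivC mul0r add0r derivB derivX.
rewrite derivC subr0 mulr1 [X in X = _ -> _]hornerD [X in _ = X -> _]hornerD.
rewrite hornerMX mulr1 horner1_shiftp hornerC => H.
by rewrite -[LHS](addrK p.[1]) H addrAC.
Qed.

(** Mean balance: a vertex with N arrivals sends N cars on, minus one when N >= 1, and the latter
    has probability 1 - g_0. *)
Lemma deriv1_genpS n :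
  (genp n.+1)^`().[1] = alpha + 2 * ((genp n)^`().[1] - (1 - (genp n)`_0)).
Proof.
have derivM1 (p q : {poly R}) :
    (p * q)^`().[1] = p^`().[1] * q.[1] + p.[1] * q^`().[1].
  by rewrite derivM hornerD !hornerM.
rewrite /= !derivM1 deriv1_shiftp hornerM horner1_shiftp horner1_eta_poly.
rewrite horner1_genp /eta_poly !(derivD, derivC, derivM, derivXn) !hornerE /=.
by field.
Qed.

End GeneratingPolynomials.

(** * Bounds on the mean, and the invariant for the lower bound *)

Section NonnegativePolynomials.
Variables (R : realType).
Implicit Types p q : {poly R}.

Definition nonneg_poly p := forall i, 0 <= p`_i.

Lemma nonneg_polyM p q : nonneg_poly p -> nonneg_poly q -> nonneg_poly (p * q).
Proof.
by move=> p0 q0 i; rewrite coefM; apply: sumr_ge0 => j _; apply: mulr_ge0.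
Qed.

Lemma nonneg_shiftp p : nonneg_poly p -> nonneg_poly (shiftp p).
Proof.
by move=> p0 i; rewrite coef_shiftp; case: ifP => _; rewrite ?addr0 ?addr_ge0.
Qed.

Lemma nonneg_genp (alpha : R) n : 0 <= alpha <= 2 -> nonneg_poly (genp alpha n).
Proof.
move=> alpha02; have phi0 : nonneg_poly (eta_poly alpha).
  by move=> k; rewrite coef_eta_poly; case: ifP => _; last case: ifP => _; lra.
elim: n => //= n IHn; apply: nonneg_polyM => //.
by apply: nonneg_polyM; apply: nonneg_shiftp.
Qed.

Lemma horner_deriv1 p : p^`().[1] = \sum_(i < size p) i%:R * p`_i.
Proof.
have [->|p0] := eqVneq p 0; first by rewrite size_poly0 big_ord0 derivC horner0.
have -> : p^`().[1] = \sum_(i < (size p).-1) p^`()`_i * 1 ^+ i.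
  by apply: horner_coef_wide; rewrite size_poly.
rewrite -[in RHS](prednK (_ : 0 < size p)%N) ?size_poly_gt0//.
rewrite big_ord_recl mul0r add0r; apply: eq_bigr => i _.
by rewrite expr1n mulr1 coef_deriv mulr_natl.
Qed.

Lemma coef0_le_horner1 p : nonneg_poly p -> p`_0 <= p.[1].
Proof.
move=> p0; rewrite horner_coef.
have [->|pn0] := eqVneq p 0; first by rewrite coef0 size_poly0 big_ord0.
rewrite -(prednK (_ : 0 < size p)%N) ?size_poly_gt0// big_ord_recl mulr1 lerDl.
by apply: sumr_ge0 => i _; rewrite expr1n mulr1.
Qed.

(** Termwise comparison, since i < k ^ i. *)
Lemma deriv1_le_horner p (k : nat) : nonneg_poly p -> (1 < k)%N ->
  p^`().[1] <= p.[k%:R].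
Proof.
move=> p0 k1; rewrite horner_deriv1 horner_coef; apply: ler_sum => i _.
by rewrite mulrC ler_wpM2l// -natrX ler_nat ltnW// ltn_expl.
Qed.

(* The left-hand side is E min(N, K) when [p] generates the law of N. *)
Lemma deriv1_ge_truncated p (K : nat) : nonneg_poly p -> p.[1] = 1 ->
  K%:R - \sum_(i < K) (K - i)%:R * p`_i <= p^`().[1].
Proof.
move=> p0 p1; rewrite horner_deriv1 lerBlDr.
(* All sums are extended to the range [m]: the truncated difference [K - i] vanishes for i >= K, and
   the coefficients vanish from [size p] on. It then suffices that K <= i + (K - i). *)
pose m := maxn K (size p).
have -> : \sum_(i < K) (K - i)%:R * p`_i = \sum_(i < m) (K - i)%:R * p`_i.
  rewrite (big_ord_widen m (fun i : nat => (K - i)%:R * p`_i)) ?leq_maxl//.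
  rewrite big_mkcond; apply: eq_bigr => i _; case: ifPn => //=.
  by rewrite -leqNgt -subn_eq0 => /eqP->; rewrite mul0r.
have widen (w : nat -> R) :
    \sum_(i < size p) w i * p`_i = \sum_(i < m) w i * p`_i.
  rewrite (big_ord_widen m (fun i : nat => w i * p`_i)) ?leq_maxr//.
  rewrite big_mkcond; apply: eq_bigr => i _; case: ifPn => //=.
  by rewrite -leqNgt => le_p_i; rewrite nth_default ?mulr0.
rewrite widen -big_split /=.
have -> : K%:R = \sum_(i < m) K%:R * p`_i.
  rewrite -(widen (fun=> K%:R)) -mulr_sumr.
  rewrite -[LHS]mulr1; congr (_ * _); rewrite -[LHS]p1 horner_coef.
  by apply: eq_bigr => i _; rewrite expr1n mulr1.
by apply: ler_sum => i _; rewrite -mulrDl ler_wpM2r// -natrD ler_nat -leq_subLR.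
Qed.

(** Here phi(4) = 1.24. If G_n(4) <= 3 and g_0 <= 0.984, the shifted polynomial at 4 is at most (3 +
    3 * 0.984) / 4 = 1.488, and 1.24 * 1.488 ^ 2 < 3. *)
Lemma horner4_genp_le3 n : (genp (32 / 1000 : R) n).[4] <= 3.
Proof.
have a02 : 0 <= (32 / 1000 : R) <= 2 by lra.
(* No arrival at all requires no initial car, which has probability 1 - 16/1000. *)
have coef0_le k : (genp (32 / 1000 : R) k)`_0 <= 984 / 1000.
  case: k => [|k] /=; first by rewrite coef_eta_poly /=; lra.
  have K0 := nonneg_shiftp (nonneg_genp k a02).
  rewrite coefM big_ord1 coefM big_ord1 coef_eta_poly /=.
  have := coef0_le_horner1 K0; rewrite horner1_shiftp horner1_genp.
  by have := K0 0%N; nra.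
have eta4 : (eta_poly (32 / 1000 : R)).[4] = 124 / 100.
  by rewrite /eta_poly !hornerE /=; field.
elim: n => [|n IHn] /=; first by rewrite eta4; lra.
rewrite hornerM eta4 hornerM.
have := horner_shiftp (genp (32 / 1000 : R) n) 4.
have G0 : 0 <= (genp (32 / 1000 : R) n).[4].
  rewrite horner_coef; apply: sumr_ge0 => i _.
  by rewrite mulr_ge0 ?nonneg_genp// exprn_ge0.
have := coef0_le n; have := nonneg_genp n a02 0%N.
move: (shiftp _).[4] => k; nra.
Qed.

End NonnegativePolynomials.

(** * Subtrees: the descendants of v, with v itself, are the words with suffix v *)

Section Descendants.
Implicit Types u v : vertex.

Lemma suffix_cons_trans b v u : suffix (b :: v) u -> suffix v u.
Proof. by case/suffixP=> s ->; rewrite -cat_rcons suffix_suffix. Qed.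

Lemma suffix_consN b v : ~~ suffix (b :: v) v.
Proof. by apply/negP => /size_suffix; rewrite ltnn. Qed.

Lemma suffix_sibling v u : suffix (false :: v) u -> ~~ suffix (true :: v) u.
Proof.
by rewrite !suffixE => /eqP /= ->; rewrite eqseq_cons.
Qed.

End Descendants.

(** * The law of the number of arrivals is given by [genp] *)

Section Law.
Variables (d : measure_display) (T : measurableType d) (R : realType).
Variables (P : probability T R).

Definition pr (A : set T) : R := fine (P A).

Lemma pr_EFin A : measurable A -> P A = (pr A)%:E.
Proof. by move=> mA; rewrite /pr fineK ?fin_num_measure. Qed.

Lemma pr_setU A B : measurable A -> measurable B -> A `&` B = set0 ->
  pr (A `|` B) = pr A + pr B.
Proof.
move=> mA mB AB0; rewrite /pr measureU// fineD ?fin_num_measure//.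
Qed.

Lemma pr_ge0 A : 0 <= pr A.
Proof. by rewrite fine_ge0. Qed.

Lemma le_pr A B : measurable A -> measurable B -> A `<=` B -> pr A <= pr B.
Proof.
by move=> mA mB AB; rewrite fine_le ?fin_num_measure ?le_measure ?inE.
Qed.

Lemma pr_bigsetU n (A : nat -> set T) : (forall i, measurable (A i)) ->
  (forall i j, i != j -> A i `&` A j = set0) ->
  pr (\big[setU/set0]_(i < n) A i) = \sum_(i < n) pr (A i).
Proof.
move=> mA A0; elim: n => [|n IHn]; first by rewrite !big_ord0 /pr measure0.
rewrite !big_ord_recr /= pr_setU ?IHn//; first exact: bigsetU_measurable.
rewrite setIC big_distrr /= big1// => i _.
by rewrite A0 // gtn_eqF.
Qed.

Definition discrete_rv (f : T -> nat) :=
  forall B : set nat, measurable (f @^-1` B).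

Lemma discrete_rv_op (op : nat -> nat -> nat) (f g : T -> nat) :
  discrete_rv f -> discrete_rv g -> discrete_rv (fun w => op (f w) (g w)).
Proof.
move=> mf mg B.
rewrite (_ : _ @^-1` B =
    \bigcup_i (f @^-1` [set i] `&` g @^-1` [set j | B (op i j)])).
  by apply: bigcup_measurable => i _; apply: measurableI.
apply/seteqP; split=> w /=; first by move=> Bw; exists (f w).
by case=> i _ [/= ->].
Qed.

Lemma discrete_rv_comp (h : nat -> nat) (f : T -> nat) :
  discrete_rv f -> discrete_rv (h \o f).
Proof. by move=> mf B; rewrite comp_preimage; exact: mf. Qed.

(** Convolution relative to an event [D], which carries what has already been fixed outside the
    subtrees under study. *)
Lemma pr_addn (p q : {poly R}) (f g : T -> nat) (D : set T) k :
  discrete_rv f -> discrete_rv g -> measurable D ->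
  (forall i j, pr (f @^-1` [set i] `&` g @^-1` [set j] `&` D) =
               p`_i * q`_j * pr D) ->
  pr ((fun w => (f w + g w)%N) @^-1` [set k] `&` D) = (p * q)`_k * pr D.
Proof.
move=> mf mg mD fgD; rewrite coefM mulr_suml.
rewrite -(eq_bigr _ (fun (i : 'I_k.+1) _ => fgD i (k - i)%N)).
pose A i := f @^-1` [set i] `&` g @^-1` [set (k - i)%N] `&` D.
rewrite -(@pr_bigsetU k.+1 A).
- rewrite -(bigcup_mkord k.+1 A); congr pr; apply/seteqP; split => w /=.
    case=> fgk Dw; exists (f w) => /=; first by rewrite -fgk ltnS leq_addr.
    by split=> //; split=> //=; rewrite -fgk addKn.
  by move=> -[i /= ltik [[/= -> ->] Dw]]; rewrite subnKC.
- by move=> i; apply: measurableI => //; apply: measurableI.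
- move=> i j ij; apply/seteqP; split=> // w [[[/= fi _] _] [[fj _] _]].
  by move: ij; rewrite -fi -fj eqxx.
Qed.

Variables (eta : vertex -> T -> nat).
Hypothesis eta_discrete : forall v, discrete_rv (eta v).
Hypothesis eta_indep : @mutually_independent _ T R P _ (fun=> nat) eta.

Definition cylinder (J : seq vertex) (B : vertex -> set nat) : set T :=
  \bigcap_(v in [set` J]) (eta v @^-1` B v).

Lemma measurable_cylinder J B : measurable (cylinder J B).
Proof.
by apply: fin_bigcap_measurable => // v _; exact: eta_discrete.
Qed.

Lemma cylinder1 v B : cylinder [:: v] B = eta v @^-1` B v.
Proof.
apply/seteqP; split=> w; first by apply; rewrite /= mem_head.
by move=> Bw u /=; rewrite inE => /eqP ->.
Qed.

Lemma cylinderI J1 J2 B1 B2 : (forall u, u \in J1 -> u \notin J2) ->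
  cylinder J1 B1 `&` cylinder J2 B2 =
  cylinder (J1 ++ J2) (fun u => if u \in J1 then B1 u else B2 u).
Proof.
move=> J12; apply/seteqP; split=> w.
  move=> [w1 w2] u /=; rewrite mem_cat; case: ifPn => [u1 _|_ /= u2].
    exact: w1.
  exact: w2.
move=> w12; split=> u /= uJ.
  by have := w12 u; rewrite /= mem_cat uJ => /(_ isT).
have := w12 u; rewrite /= mem_cat uJ orbT => /(_ isT).
by case: ifPn => // /J12; rewrite uJ.
Qed.

(* [D] is independent of the initial cars in the subtree of [v]. *)
Definition indep_below (D : set T) (v : vertex) : Prop :=
  measurable D /\
  forall J B, uniq J -> all (suffix v) J ->
    pr (D `&` cylinder J B) = pr D * \prod_(u <- J) pr (eta u @^-1` B u).

(** Since [J] avoids the subtree of [w], a cylinder over [J] and one below [w] merge into a single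
    cylinder below [v]. This moves independence from a vertex down to its children. *)
Lemma indep_below_cylinder D v w J B :
  indep_below D v -> uniq J -> all (suffix v) J ->
  suffix v w -> {in J, forall u, ~~ suffix w u} ->
  indep_below (D `&` cylinder J B) w.
Proof.
move=> [mD ibD] uJ /allP vJ vw Jw; split.
  by apply: measurableI => //; exact: measurable_cylinder.
move=> J' B' uJ' /allP wJ'.
have JJ' u : u \in J -> u \notin J'.
  by move=> /Jw; apply: contra => /wJ'.
have uJJ' : uniq (J ++ J').
  rewrite cat_uniq uJ uJ' andbT; apply/hasPn => u uJ'u.
  by apply/negP => /JJ'; rewrite uJ'u.
rewrite -setIA cylinderI// ibD//; last first.
  rewrite all_cat; apply/andP; split; apply/allP => u; first exact: vJ.
  by move/wJ'; exact: suffix_trans.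
rewrite ibD//; last exact/allP.
rewrite big_cat /= mulrA; congr (_ * _ * _).
  by apply: eq_big_seq => u ->.
apply: eq_big_seq => u uJ'u; case: ifPn => // /JJ'; by rewrite uJ'u.
Qed.

Lemma indep_belowT v : indep_below setT v.
Proof.
split=> // J B uJ _; rewrite setTI /pr probability_setT mul1r.
rewrite eta_indep//.
transitivity (fine (\prod_(i <- J) (pr (eta i @^-1` B i))%:E)).
  by congr fine; apply: eq_bigr => i _; rewrite pr_EFin//; exact: eta_discrete.
by rewrite prodEFin.
Qed.

Variables (alpha : R) (tie : vertex -> forall n : nat, T -> 'I_n.+1).
Hypothesis eta_law :
  forall v k, pr (eta v @^-1` [set k]) = (eta_poly alpha)`_k.

Definition visit_count (n : nat) (v : vertex) (w : T) : nat :=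
  arrivals (fun u => eta u w) (fun u m => tie u m w) n v.

Lemma visit_count_discrete n v : discrete_rv (visit_count n v).
Proof.
elim: n v => [|n IHn] v.
  rewrite (_ : visit_count 0 v = eta v) //.
  by apply/funext=> w; rewrite /visit_count arrivals0.
rewrite (_ : visit_count n.+1 v = fun w =>
   (eta v w + ((visit_count n (false :: v) w).-1
               + (visit_count n (true :: v) w).-1))%N).
  apply: discrete_rv_op => //.
  by apply: discrete_rv_op; apply: (@discrete_rv_comp predn).
by apply/funext=> w; rewrite /visit_count arrivalsS.
Qed.

Lemma pr_predn (p : {poly R}) (f : T -> nat) (D : set T) i :
  discrete_rv f -> measurable D ->
  (forall k, pr (f @^-1` [set k] `&` D) = p`_k * pr D) ->
  pr ((predn \o f) @^-1` [set i] `&` D) = (shiftp p)`_i * pr D.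
Proof.
move=> mf mD fD; rewrite coef_shiftp mulrDl -fD.
case: i => [|i] /=; last first.
  rewrite mul0r addr0; congr pr; congr (_ `&` _).
  by apply/seteqP; split=> w /=; lia.
(* The value 0 of the truncated predecessor comes from both f = 1 and f = 0. *)
rewrite -fD -pr_setU; [|exact: measurableI|exact: measurableI|].
  rewrite -setIUl; congr pr; congr (_ `&` _).
  by apply/seteqP; split=> w /=; lia.
by apply/seteqP; split=> // w /= [[+ _] [+ _]]; lia.
Qed.

(** Quantifying over [D] in the induction encodes the independence of the two subtrees: the event
    for one child is absorbed into the [D] used for the other. *)
Lemma pr_visit_count_setI n v D k : indep_below D v ->
  pr (visit_count n v @^-1` [set k] `&` D) = (genp alpha n)`_k * pr D.
Proof.
elim: n v D k => [|n IHn] v D k ibD.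
  have -> : visit_count 0 v @^-1` [set k] `&` D =
            D `&` cylinder [:: v] (fun=> [set k]).
    rewrite setIC cylinder1; congr (_ `&` _).
    by apply/seteqP; split=> w /=; rewrite /visit_count arrivals0.
  by rewrite ibD.2//= ?suffix_refl// big_seq1 eta_law mulrC.
have -> : visit_count n.+1 v = fun w =>
    (eta v w + ((predn \o visit_count n (false :: v)) w
                + (predn \o visit_count n (true :: v)) w))%N.
  by apply/funext=> w; rewrite /visit_count arrivalsS.
have mpred b : discrete_rv (predn \o visit_count n (b :: v)).
  by apply: discrete_rv_comp; exact: visit_count_discrete.
apply: pr_addn => //; [exact: discrete_rv_op|exact: ibD.1|move=> a j].
pose D1 := D `&` cylinder [:: v] (fun=> [set a]).
have D1E : eta v @^-1` [set a] `&` D = D1.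
  by rewrite setIC /D1 cylinder1.
have prD1 : pr D1 = (eta_poly alpha)`_a * pr D.
  by rewrite ibD.2//= ?suffix_refl// big_seq1 eta_law mulrC.
have ibD1 b : indep_below D1 (b :: v).
  apply: indep_below_cylinder ibD _ _ _ _ => //=; rewrite ?suffix_refl//.
    exact: suffix_cons_trans (suffix_refl _).
  by move=> u; rewrite inE => /eqP ->; exact: suffix_consN.
pose K := shiftp (genp alpha n).
rewrite setIAC setIC D1E (@pr_addn K K)//.
- by rewrite prD1 mulrCA mulrA.
- exact: (ibD1 true).1.
- move=> i l; rewrite (setIC (_ @^-1` [set i])) -setIA.
  have pr_pred D' b i' : indep_below D' (b :: v) ->
      pr ((predn \o visit_count n (b :: v)) @^-1` [set i'] `&` D') =
      (shiftp (genp alpha n))`_i' * pr D'.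
    move=> ibD'; apply: pr_predn; [exact: visit_count_discrete|exact: ibD'.1|].
    by move=> k'; exact: IHn.
  rewrite pr_pred; first by rewrite pr_pred// mulrA (mulrC _`_l).
  (* The event for [false :: v] must be independent of cylinders below [true :: v]. Such a cylinder
     is joined to [D1], and the induction hypothesis at [false :: v] factors the probability. *)
  split; first by apply: measurableI; [exact: mpred|exact: (ibD1 true).1].
  move=> J B uJ J1; rewrite -setIA !pr_pred//.
    by rewrite (ibD1 true).2// mulrA.
  rewrite /D1 -setIA cylinderI; last first.
    move=> u; rewrite inE => /eqP ->; apply/negP => /(allP J1).
    by apply/negP; exact: suffix_consN.
  apply: indep_below_cylinder ibD _ _ _ _ => //=.
  + rewrite uJ andbT; apply/negP => /(allP J1).
    by apply/negP; exact: suffix_consN.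
  + rewrite suffix_refl /=; apply/allP => u /(allP J1).
    exact: suffix_cons_trans.
  + exact: suffix_cons_trans (suffix_refl _).
  + move=> u; rewrite inE => /predU1P[->|/(allP J1) uJ1].
      exact: suffix_consN.
    by apply: contraL uJ1; exact: suffix_sibling.
Qed.

Lemma pr_visit_count n k :
  pr (visit_count n [::] @^-1` [set k]) = (genp alpha n)`_k.
Proof.
rewrite -[X in pr X]setIT (@pr_visit_count_setI n [::] setT k (indep_belowT _)).
by rewrite /pr probability_setT mulr1.
Qed.

End Law.

(** * The algebra that excludes a limit law at density 2/23 *)

Section Contradiction.
Variable (R : realType).
Implicit Types s : R.

(* This quintic is s^3 (E min(N, 6) - m) for the law of [no_limit_law]; its
   minimum over the interval is about 3e-6, near [r]. *)
Lemma quintic_gt0 s (p0 : R := (23 / 22) ^+ 4 / 128)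
    (p2 : R := 379 * 23 ^+ 2 / (2 ^+ 8 * 11 ^+ 3))
    (p3 : R := 3 * (7583 / 44) / 253)
    (p4 : R := 9 * 23 * 181 / (2 ^+ 7 * 11 ^+ 2)) :
  62 / 100 <= s <= 1 ->
  0 < p0 - p2 * s ^+ 2 + p3 * s ^+ 3 - p4 * s ^+ 4 + 22 / 23 * s ^+ 5.
Proof.
(* [r] approximates the minimiser, and [q] is the quotient of the quintic by (s - r) ^ 2, so the
   remainder is the tangent line at [r]. *)
move=> s1; pose r : R := 925 / 1000 + 1 / 10 ^+ 4; pose p5 : R := 22 / 23.
pose q s := p5 * s ^+ 3 + (2 * r * p5 - p4) * s ^+ 2
  + (3 * r ^+ 2 * p5 - 2 * r * p4 + p3) * s
  + (4 * r ^+ 3 * p5 - 3 * r ^+ 2 * p4 + 2 * r * p3 - p2).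
have q0 : 0 < q s.
  (* Expanded in k = s - 62/100, the cubic [q] has only positive coefficients. *)
  have [k [-> k0]] : exists k, s = 62 / 100 + k /\ 0 <= k.
    by exists (s - 62 / 100); split; lra.
  have k2 : 0 <= k ^+ 2 by rewrite exprn_ge0.
  have k3 : 0 <= k ^+ 3 by rewrite exprn_ge0.
  by rewrite /q /r /p2 /p3 /p4 /p5; lra.
rewrite -/p5.
have -> : p0 - p2 * s ^+ 2 + p3 * s ^+ 3 - p4 * s ^+ 4 + p5 * s ^+ 5 =
  (s - r) ^+ 2 * q s
  + ((p0 - p2 * r ^+ 2 + p3 * r ^+ 3 - p4 * r ^+ 4 + p5 * r ^+ 5)
  + (- 2 * p2 * r + 3 * p3 * r ^+ 2 - 4 * p4 * r ^+ 3 + 5 * p5 * r ^+ 4)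
    * (s - r)).
  by rewrite /q; ring.
rewrite ltr_wpDl//; first by rewrite mulr_ge0 ?sqr_ge0// ltW.
by rewrite /r /p0 /p2 /p3 /p4 /p5; lra.
Qed.

(* At density 2/23 a limit law [g] with mean 2 (1 - g 0) - 2/23 would have to
   dominate its truncated means E min(N, 3) and E min(N, 6). *)
Lemma no_limit_law (g0 g1 g2 g3 g4 g5 s : R) : s = g0 + g1 -> 0 < s <= 1 ->
  g0 = 22 / 23 * s ^+ 2 ->
  g1 = 22 / 23 * (2 * s * g2) ->
  g2 = 22 / 23 * (2 * s * g3 + g2 ^+ 2) + 1 / 23 * s ^+ 2 ->
  g3 = 22 / 23 * (2 * s * g4 + 2 * g2 * g3) + 1 / 23 * (2 * s * g2) ->
  g4 = 22 / 23 * (2 * s * g5 + 2 * g2 * g4 + g3 ^+ 2)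
       + 1 / 23 * (2 * s * g3 + g2 ^+ 2) ->
  3 - (3 * g0 + 2 * g1 + g2) <= 2 * (1 - g0) - 2 / 23 ->
  6 - (6 * g0 + 5 * g1 + 4 * g2 + 3 * g3 + 2 * g4 + g5)
    <= 2 * (1 - g0) - 2 / 23 -> False.
Proof.
move=> sE /andP[s0 s1] e0 e1 e2 e3 e4 le3 le6.
have sn0 : s != 0 by rewrite gt_eqF.
have g1E : g1 = s - 22 / 23 * s ^+ 2 by rewrite -e0 sE addrC addKr.
(* Equate [e1] with g1 = s - g0 and cancel s. *)
have g2E : g2 = 23 / 44 - s / 2.
  apply: (mulfI sn0); rewrite (_ : s * g2 = 23 / 44 * g1).
    by rewrite g1E; field.
  by rewrite e1; field.
(* The bound on E min(N, 3) is a quadratic inequality in s whose smaller root is about 0.626. *)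
have s62 : 62 / 100 <= s.
  rewrite leNgt; apply/negP => s62.
  by move: le3; rewrite e0 g1E g2E; clear -s0 s62; nra.
(* Each equation yields the next coefficient; the products with s avoid division. *)
have g3E : s * g3 = 529 / 3872 - 13 / 88 * s ^+ 2.
  by move: e2; rewrite g2E; clear => e2; lra.
have g4E : g4 = (g3 - g2 / 11) / 2.
  apply: (mulfI sn0); move: e3; rewrite g2E; clear => e3; lra.
have g5E : s * g5 = s * g4 / 2 - g3 ^+ 2 / 2 - (2 * (s * g3) + g2 ^+ 2) / 44.
  by move: e4; rewrite g2E; clear => e4; lra.
have := @quintic_gt0 s; rewrite s62 s1 => /(_ isT).
(* The factor s ^ 3 clears denominators: s * g5 contains g3 ^ 2, which needs two further factors
   s. *)
have : 0 <= s ^+ 3 * ((2 * (1 - g0) - 2 / 23)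
    - (6 - (6 * g0 + 5 * g1 + 4 * g2 + 3 * g3 + 2 * g4 + g5))).
  by rewrite mulr_ge0 ?exprn_ge0 ?subr_ge0// ltW.
have -> : s ^+ 3 * ((2 * (1 - g0) - 2 / 23)
    - (6 - (6 * g0 + 5 * g1 + 4 * g2 + 3 * g3 + 2 * g4 + g5))) =
  s ^+ 3 * ((2 * (1 - g0) - 2 / 23)
    - (6 - (6 * g0 + 5 * g1 + 4 * g2 - g2 / 11)))
  + s ^+ 2 * (4 * (s * g3)) + s ^+ 2 * (s * g5).
  by rewrite g4E; field.
rewrite g5E g4E.
have -> : s ^+ 2 * (s * ((g3 - g2 / 11) / 2) / 2 - g3 ^+ 2 / 2
      - (2 * (s * g3) + g2 ^+ 2) / 44) =
  s ^+ 2 * (s * g3 / 4 - s * g2 / 44 - (2 * (s * g3) + g2 ^+ 2) / 44)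
  - (s * g3) ^+ 2 / 2.
  by field.
rewrite g3E e0 g1E g2E; clear => h1 h2; lra.
Qed.

End Contradiction.

(** * Passage to the limit at density 2/23 *)

Section Limit.
Variable (R : realType).

Lemma coef_genpS (alpha : R) n (g := fun k => (genp alpha n)`_k)
    (b := 1 - alpha / 2) (s := g 0%N + g 1%N) :
  [/\ (genp alpha n.+1)`_0 = b * s ^+ 2,
      (genp alpha n.+1)`_1 = b * (2 * s * g 2%N),
      (genp alpha n.+1)`_2 = b * (2 * s * g 3%N + g 2%N ^+ 2)
                             + alpha / 2 * s ^+ 2,
      (genp alpha n.+1)`_3 = b * (2 * s * g 4%N + 2 * g 2%N * g 3%N)
                             + alpha / 2 * (2 * s * g 2%N) &
      (genp alpha n.+1)`_4 = b * (2 * s * g 5%N + 2 * g 2%N * g 4%N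
                                  + g 3%N ^+ 2)
                             + alpha / 2 * (2 * s * g 3%N + g 2%N ^+ 2)].
Proof.
rewrite /= !coefM !big_ord_recr !big_ord0 /= !coef_eta_poly /= !coefM.
rewrite !big_ord_recr !big_ord0 /= !coef_shiftp /= -/(g _) /s /b /g.
by split; ring.
Qed.

(** The cumulative sums are monotone and bounded, so each coefficient converges as a difference of
    two of them; the limits then satisfy the hypotheses of [no_limit_law]. *)
Lemma no_bounded_mean (G := genp (2 / 23 : R)) (C : R) :
  (forall k, nonincreasing_seq (fun n => \sum_(j < k) (G n)`_j)) ->
  nondecreasing_seq (fun n => (G n)^`().[1]) ->
  (forall n, (G n)^`().[1] <= C) -> False.
Proof.
move=> noninc nondec bounded.
have a02 : 0 <= (2 / 23 : R) <= 2 by lra.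
have G0 n k : 0 <= (G n)`_k := nonneg_genp n a02 k.
have cvgS k : cvgn (fun n => \sum_(j < k) (G n)`_j).
  apply: nonincreasing_is_cvgn; first exact: noninc.
  by exists 0 => _ [n _ <-]; apply: sumr_ge0.
have cvgG k : cvgn (fun n => (G n)`_k).
  rewrite (_ : (fun n => _) =
      (fun n => \sum_(j < k.+1) (G n)`_j - \sum_(j < k) (G n)`_j)).
    by apply: is_cvgB; exact: cvgS.
  by apply/funext => n; rewrite big_ord_recr /= addrAC subrr add0r.
pose g k := limn (fun n => (G n)`_k).
have Gg k : (fun n => (G n)`_k) @ \oo --> g k by exact: cvgG.
have GSg k : (fun n => (G n.+1)`_k) @ \oo --> g k.
  by rewrite (cvg_shiftS (fun n => (G n)`_k)).
have eq_lim (u v : R^nat) (l m : R) :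
    u @ \oo --> l -> v @ \oo --> m -> u = v -> l = m.
  by move=> ul vm uv; rewrite -(cvg_lim _ ul)// uv; apply: cvg_lim.
have b22 : 1 - 2 / 23 / 2 = 22 / 23 :> R by field.
have a1 : 2 / 23 / 2 = 1 / 23 :> R by field.
pose s := g 0%N + g 1%N.
have Gs : (fun n => (G n)`_0 + (G n)`_1) @ \oo --> s by apply: cvgD.
have cM (c : R) (u : R^nat) l :
    u @ \oo --> l -> (fun n => c * u n) @ \oo --> c * l.
  by move=> ul; apply: cvgM => //; exact: cvg_cst.
have sgM i :
    (fun n => 2 * ((G n)`_0 + (G n)`_1) * (G n)`_i) @ \oo --> 2 * s * g i.
  by apply: cvgM; [exact: cM|exact: Gg].
have ggM i j : (fun n => 2 * (G n)`_i * (G n)`_j) @ \oo --> 2 * g i * g j.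
  by apply: cvgM; [exact: cM|exact: Gg].
have gg i : (fun n => (G n)`_i ^+ 2) @ \oo --> g i ^+ 2.
  by rewrite expr2; apply: cvgM.
have ss : (fun n => ((G n)`_0 + (G n)`_1) ^+ 2) @ \oo --> s ^+ 2.
  by rewrite expr2; apply: cvgM.
have e0 : g 0%N = 22 / 23 * s ^+ 2.
  apply: (eq_lim _ _ _ _ (GSg 0%N) (cM _ _ _ ss)).
  apply/funext => n; have [-> _ _ _ _] := coef_genpS (2 / 23 : R) n.
  by rewrite b22.
have e1 : g 1%N = 22 / 23 * (2 * s * g 2%N).
  apply: (eq_lim _ _ _ _ (GSg 1%N) (cM _ _ _ (sgM 2%N))).
  apply/funext => n; have [_ -> _ _ _] := coef_genpS (2 / 23 : R) n.
  by rewrite b22.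
have e2 : g 2%N = 22 / 23 * (2 * s * g 3%N + g 2%N ^+ 2) + 1 / 23 * s ^+ 2.
  apply: (eq_lim _ _ _ _ (GSg 2%N)
    (cvgD (cM _ _ _ (cvgD (sgM 3%N) (gg 2%N))) (cM _ _ _ ss))).
  apply/funext => n; have [_ _ -> _ _] := coef_genpS (2 / 23 : R) n.
  by rewrite b22 a1.
have e3 : g 3%N = 22 / 23 * (2 * s * g 4%N + 2 * g 2%N * g 3%N)
    + 1 / 23 * (2 * s * g 2%N).
  apply: (eq_lim _ _ _ _ (GSg 3%N)
    (cvgD (cM _ _ _ (cvgD (sgM 4%N) (ggM 2%N 3%N))) (cM _ _ _ (sgM 2%N)))).
  apply/funext => n; have [_ _ _ -> _] := coef_genpS (2 / 23 : R) n.
  by rewrite b22 a1.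
have e4 : g 4%N = 22 / 23 * (2 * s * g 5%N + 2 * g 2%N * g 4%N + g 3%N ^+ 2)
    + 1 / 23 * (2 * s * g 3%N + g 2%N ^+ 2).
  apply: (eq_lim _ _ _ _ (GSg 4%N)
    (cvgD (cM _ _ _ (cvgD (cvgD (sgM 5%N) (ggM 2%N 4%N)) (gg 3%N)))
          (cM _ _ _ (cvgD (sgM 3%N) (gg 2%N))))).
  apply/funext => n; have [_ _ _ _ ->] := coef_genpS (2 / 23 : R) n.
  by rewrite b22 a1.
have g_ge0 k : 0 <= g k.
  by apply: limr_ge; [exact: cvgG|apply: nearW => n; exact: G0].
have cvgm : cvgn (fun n => (G n)^`().[1]).
  apply: nondecreasing_is_cvgn => //.
  by exists C => _ [n _ <-].
pose m := limn (fun n => (G n)^`().[1]).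
(* As [m] is a finite limit, the mean recursion becomes a linear equation that can be solved for
   [m]. *)
have mE : m = 2 * (1 - g 0%N) - 2 / 23.
  have : m = 2 / 23 + 2 * (m - (1 - g 0%N)).
    apply: (eq_lim (fun n => (G n.+1)^`().[1]) (fun n => 2 / 23
      + 2 * ((G n)^`().[1] - (1 - (G n)`_0)))).
    - by rewrite (cvg_shiftS (fun n => (G n)^`().[1])).
    - apply: cvgD; first exact: cvg_cst.
      apply: cM; apply: cvgB => //.
      by apply: cvgB => //; exact: cvg_cst.
    - by apply/funext => n; exact: deriv1_genpS.
  by clear; lra.
have cvgsum (w : nat -> R) K :
    (fun n => \sum_(i < K) w i * (G n)`_i) @ \oo --> \sum_(i < K) w i * g i.
  elim: K => [|K IHK].
    rewrite big_ord0 (_ : (fun n => _) = fun=> 0); first exact: cvg_cst.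
    by apply/funext => n; rewrite big_ord0.
  rewrite big_ord_recr /= (_ : (fun n => _) = fun n =>
      \sum_(i < K) w i * (G n)`_i + w K * (G n)`_K).
    by apply: cvgD => //; exact: cM.
  by apply/funext => n; rewrite big_ord_recr.
(* E min(N, K) involves only the first K coefficients, so it passes to the limit. *)
have trunc K : K%:R - \sum_(i < K) (K - i)%:R * g i <= m.
  have sumg : (fun n => K%:R - \sum_(i < K) (K - i)%:R * (G n)`_i) @ \oo -->
      K%:R - \sum_(i < K) (K - i)%:R * g i.
    apply: cvgB; first exact: cvg_cst.
    exact: (cvgsum (fun i => (K - i)%:R)).
  rewrite -(cvg_lim _ sumg)//; apply: ler_lim => //; first exact: cvgP sumg.
  apply: nearW => n; apply: deriv1_ge_truncated; first exact: nonneg_genp.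
  exact: horner1_genp.
have S2 n : (G n)`_0 + (G n)`_1 <= 1.
  have := noninc 2%N 0%N n (leq0n n).
  rewrite !big_ord_recr !big_ord0 /= !add0r !coef_eta_poly /=; lra.
have s_le1 : s <= 1.
  by rewrite -(cvg_lim _ Gs)//; apply: limr_le; [exact: cvgP Gs|exact: nearW].
have le3 : 3 - (3 * g 0%N + 2 * g 1%N + 1 * g 2%N) <= m.
  by have := trunc 3%N; rewrite !big_ord_recr big_ord0 /= add0r.
have le6 : 6 - (6 * g 0%N + 5 * g 1%N + 4 * g 2%N + 3 * g 3%N + 2 * g 4%N
    + 1 * g 5%N) <= m.
  by have := trunc 6%N; rewrite !big_ord_recr big_ord0 /= add0r.
rewrite mE mul1r in le3; rewrite mE mul1r in le6.
have s_gt0 : 0 < s.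
  rewrite lt0r; apply/andP; split; last by rewrite addr_ge0.
  (* If s = 0, then g 2 = 22/23 * g 2 ^ 2, whose nonzero root 23/22 exceeds 1. Hence g 2 = 0, and
     [le3] would read 3 <= 2 - 2/23. *)
  apply/eqP => s0.
  have g00 : g 0%N = 0 by rewrite e0 s0 expr0n mulr0.
  have g10 : g 1%N = 0 by rewrite e1 s0 mulr0 mul0r mulr0.
  have g2_le1 : g 2%N <= 1.
    apply: limr_le; first exact: cvgG.
    apply: nearW => n; have := noninc 3%N 0%N n (leq0n n).
    rewrite !big_ord_recr !big_ord0 /= !coef_eta_poly /=.
    by have := G0 n 0%N; have := G0 n 1%N; lra.
  have g20 : g 2%N = 0.
    have : g 2%N * (1 - 22 / 23 * g 2%N) = 0.
      by rewrite mulrBr mulr1 {1}e2 s0; ring.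
    move/eqP; rewrite mulf_eq0 => /orP[/eqP//|/eqP g2E]; exfalso.
    by move: g2_le1 g2E; clear; lra.
  by move: le3; rewrite g00 g10 g20; clear; lra.
apply: (@no_limit_law R (g 0%N) (g 1%N) (g 2%N) (g 3%N) (g 4%N) (g 5%N) s) =>
  //.
by rewrite s_gt0.
Qed.

End Limit.

(** * The mean of a discrete variable from its generating polynomial *)

Section Mean.
Variables (d : measure_display) (T : measurableType d) (R : realType).
Variable (P : probability T R).

Lemma discrete_rv_measurable (f : T -> nat) : discrete_rv f ->
  measurable_fun setT (fun w => (f w)%:R%:E : \bar R).
Proof.
by move=> mf _ Y mY; rewrite setTI; exact: (mf ((fun k => k%:R%:E) @^-1` Y)).
Qed.

Lemma pr_ltn (f : T -> nat) k : discrete_rv f ->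
  pr P (f @^-1` [set i | (i < k)%N]) =
  \sum_(i < k) pr P (f @^-1` [set (i : nat)]).
Proof.
move=> mf.
rewrite -(@pr_bigsetU _ _ _ P k (fun i => f @^-1` [set i])) => [|//|i j ij].
  congr (pr P _); rewrite -(bigcup_mkord k (fun i => f @^-1` [set i])).
  apply/seteqP; split=> w /= => [fk|[i /= ik ->]//].
  by exists (f w).
apply/seteqP; split=> // w [/= fi fj].
by move: ij; rewrite -fi -fj eqxx.
Qed.

(** As the coefficients sum to one, f < [size p] almost surely, so f agrees almost everywhere with a
    finite combination of indicators. *)
Lemma integral_discrete_rv (f : T -> nat) (p : {poly R}) : discrete_rv f ->
  (forall k, pr P (f @^-1` [set k]) = p`_k) -> p.[1] = 1 ->
  (\int[P]_w (f w)%:R%:E = (p^`().[1])%:E)%E.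
Proof.
move=> mf fp p1.
pose g w : \bar R :=
  (\sum_(k < size p) k%:R%:E * (\1_(f @^-1` [set (k : nat)]) w)%:E)%E.
have m1 (k : nat) : measurable_fun setT
    (fun w => (\1_(f @^-1` [set k]) w)%:E : \bar R).
  by apply/measurable_EFinP; apply: measurable_indic; exact: mf.
have mterm (k : nat) : measurable_fun setT
    (fun w => (k%:R%:E * (\1_(f @^-1` [set k]) w)%:E)%E : \bar R).
  by apply: measurable_funeM.
rewrite (@ge0_ae_eq_integral _ _ _ P setT _ g) //.
- rewrite /g ge0_integral_sum => [|//|k|k w _]; first last.
  + by rewrite mule_ge0// lee_fin.
  + exact: mterm.
  rewrite horner_deriv1 -sumEFin; apply: eq_bigr => k _.
  rewrite ge0_integralZl_EFin// integral_indic//.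
  by rewrite setIT EFinM -fp; congr (_ * _)%E; exact: pr_EFin (mf _).
- exact: discrete_rv_measurable.
- exact: emeasurable_sum.
- by move=> w _; apply: sume_ge0 => k _; rewrite mule_ge0// lee_fin.
- exists (f @^-1` [set i | (size p <= i)%N]); split; first exact: mf.
  + transitivity ((pr P (f @^-1` [set i | (size p <= i)%N]))%:E).
      exact: pr_EFin (mf _).
    congr EFin; have : pr P setT = 1 by rewrite /pr probability_setT.
    rewrite (_ : setT = f @^-1` [set i | (size p <= i)%N]
                        `|` f @^-1` [set i | (i < size p)%N]); last first.
      apply/seteqP; split=> // w _ /=.
      by case: (leqP (size p) (f w)); [left|right].
    rewrite pr_setU; [|exact: mf|exact: mf|]; last first.
      by apply/seteqP; split=> // w [/= +]; rewrite ltnNge => ->.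
    rewrite pr_ltn// (_ : \sum_(i < _) _ = 1); first by lra.
    rewrite -p1 horner_coef; apply: eq_bigr => i _.
    by rewrite fp expr1n mulr1.
  + move=> w /= /not_implyP[_ fgw]; rewrite leqNgt; apply/negP => fw.
    apply: fgw; rewrite /g (bigD1 (Ordinal fw))//= big1 => [|i /eqP iw].
      by rewrite adde0 indicE mem_set// mule1.
    rewrite indicE memNset ?mule0// => /= fi.
    by apply: iw; apply/val_inj.
Qed.

End Mean.

(** * From the parking model to the generating polynomials *)

Section BernoulliParking.
Variables (R : realType) (alpha : R) (M : parking_model R).
Hypothesis HM : bernoulli_parking alpha M.

Let P := pm_prob M.
Let eta := @pm_eta R M.
Let tie := @pm_tie R M.

Let eta_discrete v : discrete_rv (eta v).
Proof. by move=> B; have [/(_ (inl v) B)] := HM. Qed.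

Let eta_indep : @mutually_independent _ _ R P _ (fun=> nat) eta.
Proof.
move=> J B uJ; have [_ indep _ _] := HM.
pose B' (i : source) : set (source_value i) :=
  match i return set (source_value i) with
  | inl v => B v
  | inr _ => setT
  end.
have := indep [seq inl v | v <- J] B'.
rewrite map_inj_uniq; last by move=> u v [].
move=> /(_ uJ); rewrite big_map /= => <-; congr (P _).
apply/seteqP; split=> w wJ; last first.
  by move=> v /= vJ; apply: (wJ (inl v)); rewrite /= map_f.
by move=> _ /= /mapP[v vJ ->]; exact: wJ.
Qed.

Let eta_law v k : pr P (eta v @^-1` [set k]) = (eta_poly alpha)`_k.
Proof.
have [_ _ /(_ v)[eta2 eta0] _] := HM.
have pr2 : pr P (eta v @^-1` [set 2%N]) = alpha / 2 by rewrite /pr /P eta2.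
have pr0 : pr P (eta v @^-1` [set 0%N]) = 1 - alpha / 2 by rewrite /pr /P eta0.
rewrite coef_eta_poly; case: eqP => [->//|k0]; case: eqP => [->//|k2].
(* The values 0 and 2 already have total mass 1, so any other k is null. *)
have : pr P (eta v @^-1` [set 0%N] `|` eta v @^-1` [set 2%N]
             `|` eta v @^-1` [set k]) <= 1.
  rewrite -[leRHS](_ : pr P setT = 1); last by rewrite /pr probability_setT.
  apply: le_pr => //.
  by apply: measurableU; [apply: measurableU|]; exact: eta_discrete.
have mv B : measurable (eta v @^-1` B) by exact: eta_discrete.
rewrite pr_setU; [|by apply: measurableU|by []|]; last first.
  by apply/seteqP; split=> // w [/= [->|->] /esym].
rewrite pr_setU//; last by apply/seteqP; split=> // w [/= ->].
by have := pr_ge0 P (eta v @^-1` [set k]); rewrite pr0 pr2; lra.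
Qed.

Let N n w := visit_count eta tie n [::] w.
Let N_discrete n : discrete_rv (N n).
Proof. exact: visit_count_discrete. Qed.

Let N_law n k : pr P (N n @^-1` [set k]) = (genp alpha n)`_k.
Proof. exact: pr_visit_count. Qed.

Let N_mean n : (\int[P]_w (N n w)%:R%:E = ((genp alpha n)^`().[1])%:E)%E.
Proof. by apply: integral_discrete_rv => //; exact: horner1_genp. Qed.

Let visit t w :=
  size (process (fun v => eta v w) (fun v n => tie v n w) t [::]).1.

Let visit_discrete t : discrete_rv (visit t).
Proof.
case: t => [|t].
  rewrite (_ : visit 0 = N 0) // /N /visit_count; apply/funext => w.
  by rewrite /arrivals big_ord_recr big_ord0.
(* Measurability is inherited from the totals, of which a single time step is a difference. *)
rewrite (_ : visit t.+1 = fun w => (N t.+1 w - N t w)%N).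
  exact: discrete_rv_op.
by apply/funext => w; rewrite /N /visit_count /arrivals big_ord_recr /= addKn.
Qed.

Let sum_visit n :
  (\sum_(0 <= t < n.+1) \int[P]_w (visit t w)%:R%:E =
   ((genp alpha n)^`().[1])%:E)%E.
Proof.
rewrite -N_mean -ge0_integral_sum//; last first.
  by move=> t; apply: discrete_rv_measurable.
apply: eq_integral => w _.
by rewrite sumEFin -natr_sum /N /visit_count /arrivals big_mkord.
Qed.

Let integral_X :
  (\int[P]_w pm_X w = \sum_(0 <= t <oo) \int[P]_w (visit t w)%:R%:E)%E.
Proof.
apply: integral_nneseries => // t.
exact: (discrete_rv_measurable (visit_discrete t)).
Qed.

Lemma measurable_X : measurable_fun setT (@pm_X R M).
Proof.
apply: ge0_emeasurable_sum => [t w _ _|t _]; first by rewrite lee_fin.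
exact: (discrete_rv_measurable (visit_discrete t)).
Qed.

Lemma mean_le_integral_X n :
  (((genp alpha n)^`().[1])%:E <= \int[P]_w pm_X w)%E.
Proof.
rewrite integral_X -sum_visit; apply: nneseries_lim_ge => t _ _.
by apply: integral_ge0 => w _; rewrite lee_fin.
Qed.

Lemma integral_X_le (C : R) : (forall n, (genp alpha n)^`().[1] <= C) ->
  (\int[P]_w pm_X w <= C%:E)%E.
Proof.
move=> leC; rewrite integral_X.
have int0 t : (0 <= \int[P]_w ((visit t w)%:R%:E : \bar R))%E.
  by apply: integral_ge0 => w _; rewrite lee_fin.
apply: lime_le; first by apply: is_cvg_nneseries.
apply: nearW => n.
(* One nonnegative term is added because [sum_visit n] includes time n. *)
apply: (@le_trans _ _
  (\sum_(0 <= t < n.+1) \int[P]_w ((visit t w)%:R%:E : \bar R))%E).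
  by rewrite [leRHS]big_nat_recr//= leeDl.
by rewrite sum_visit lee_fin.
Qed.

(** The sum is P(N_n < k), and on the common probability space N_n increases with n. *)
Lemma partial_law_nonincreasing k :
  nonincreasing_seq (fun n => \sum_(j < k) (genp alpha n)`_j).
Proof.
have sumE n :
    \sum_(j < k) (genp alpha n)`_j = pr P (N n @^-1` [set i | (i < k)%N]).
  by rewrite pr_ltn//; apply: eq_bigr => j _; rewrite N_law.
apply/nonincreasing_seqP => n; rewrite !sumE.
apply: le_pr; [exact: N_discrete|exact: N_discrete|move=> w /=].
exact: leq_ltn_trans (arrivals_homo _ _ _ _).
Qed.

Lemma mean_nondecreasing : nondecreasing_seq (fun n => (genp alpha n)^`().[1]).
Proof.
apply/nondecreasing_seqP => n; rewrite -lee_fin -!N_mean.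
apply: ge0_le_integral => //; try exact: discrete_rv_measurable.
by move=> w _; rewrite lee_fin ler_nat; exact: arrivals_homo.
Qed.

End BernoulliParking.

(** * The two bounds on the critical value *)

Theorem proposition4 (R : realType) (M : R -> parking_model R)
    (HM : forall alpha : R, 0 <= alpha <= 2 -> bernoulli_parking alpha (M alpha))
    (alpha_c : R) (Hc : is_critical_value M alpha_c) :
  3175 / 10 ^+ 5 < alpha_c /\ alpha_c < 8698 / 10 ^+ 5.
Proof.
have [/andP[c0 c1] sub super] := Hc; split; rewrite ltNge; apply/negP => c_le.
(* [a] exceeds 3175 / 10 ^ 5, so it would be supercritical, with X infinite almost surely, against a
   mean of at most 3. *)
- pose a : R := 32 / 1000.
  have a02 : 0 <= a <= 2 by rewrite /a; lra.
  have ae : {ae pm_prob (M a), forall w, pm_X w = +oo%E}.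
    by apply: super; rewrite /a; move: c_le; clear; lra.
  have : (\int[pm_prob (M a)]_w pm_X w <= 3%:E)%E.
    apply: integral_X_le (HM _ a02) _ _ => n.
    apply: le_trans (horner4_genp_le3 R n).
    exact: (@deriv1_le_horner _ _ 4 (nonneg_genp n a02)).
  rewrite (@ae_eq_integral _ _ _ _ _ (cst +oo%E)) //.
  + rewrite integral_cst// (_ : (+oo * _ = +oo)%E)//.
    rewrite -[RHS]mule1; congr (_ * _)%E; exact: probability_setT.
  + exact: measurable_X (HM _ a02).
  + by apply: filterS ae => w ->.
(* 2/23 is about 0.08696, just below 8698 / 10 ^ 5, so it would be subcritical and the finite mean
   of X would bound all the means. *)
- pose a : R := 2 / 23.
  have a02 : 0 <= a <= 2 by rewrite /a; lra.
  have : (\int[pm_prob (M a)]_w pm_X w < +oo)%E.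
    by apply: sub; rewrite /a; move: c_le; clear; lra.
  have := mean_le_integral_X (HM _ a02).
  case: (integral _ _ _) => [C mean_le _| |] //; last by move/(_ 0%N).
  apply: (@no_bounded_mean R C).
  + exact: (partial_law_nonincreasing (HM _ a02)).
  + exact: (mean_nondecreasing (HM _ a02)).
  + by move=> n; rewrite -lee_fin.
Qed.
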